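(* Let $n\geq 1$. For every permutation $\sigma\in\mathfrak{S}_{n+1}$ we have $$|C(\sigma)|\leq \frac{1}{2}|R(\sigma)|+1.$$
   Context: $\mathfrak{S}_{n+1}$ is the symmetric group on $[n+1]=\{1,\ldots,n+1\}$, with product given by composition of functions read from the right; it is generated by $s_i=(i\ \ i+1)$, $i\in[n]$. A reduced word of $\sigma$ is a word $i_1i_2\cdots i_l$ with letters in $[n]$ such that $\sigma=s_{i_1}s_{i_2}\cdots s_{i_l}$ with $l$ minimal. $R(\sigma)$ is the set of reduced words of $\sigma$. A commutation replaces two consecutive letters $ij$ of a word, with $|i-j|>1$, by $ji$. Two reduced words of $\sigma$ are equivalent if they differ by a sequence of commutations; the equivalence classes are the commutation classes of $\sigma$, and $C(\sigma)$ denotes the set of all commutation classes of $\sigma$. *)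

(* Defs.v *)
From mathcomp Require Import all_boot all_fingroup.

Set Implicit Arguments.
Unset Strict Implicit.
Unset Printing Implicit Defensive.

Import GroupScope.

(* The set [n+1] is encoded as 'I_n.+1 and the set of letters [n] as 'I_n, both
   shifted down by one: the letter i : 'I_n stands for i.+1, and adj_tperm i
   exchanges the points of 'I_n.+1 with values i and i.+1. *)
Definition adj_tperm n (i : 'I_n) : 'S_n.+1 :=
  tperm (widen_ord (leqnSn n) i) (lift ord0 i).

(* The product s_(i_1) s_(i_2) ... s_(i_l), with factors composed from the
   right: the map x |-> s_(i_1) (s_(i_2) (... (s_(i_l) x))).  MathComp composes
   permutations from the left, (s * t) x = t (s x), so the factors occur in
   reverse order. *)
Definition word_perm n (w : seq 'I_n) : 'S_n.+1 :=
  foldr (fun i s => s * adj_tperm i) 1 w.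

Lemma word_perm_cons n (i : 'I_n) (w : seq 'I_n) (x : 'I_n.+1) :
  word_perm (i :: w) x = adj_tperm i (word_perm w x).
Proof. exact: permM. Qed.

Lemma word_perm_cat n (u v : seq 'I_n) :
  word_perm (u ++ v) = word_perm v * word_perm u.
Proof. by elim: u => [|i u IHu] /=; rewrite ?mulg1 // IHu mulgA. Qed.

Lemma word_perm_surj n (s : 'S_n.+1) : exists w : seq 'I_n, word_perm w = s.
Proof.
pose W (t : 'S_n.+1) := exists w : seq 'I_n, word_perm w = t.
have WM t t' : W t -> W t' -> W (t * t').
  by move=> [w <-] [w' <-]; exists (w' ++ w); rewrite word_perm_cat.
have W1 : W 1 by exists [::].
have Wadj i : W (adj_tperm i) by exists [:: i]; rewrite /= mul1g.
have W0 k (ltk : k < n.+1) : W (tperm ord0 (Ordinal ltk)).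
  elim: k ltk => [|k IHk] ltk.
    by rewrite (_ : Ordinal ltk = ord0) ?tperm1 //; apply: val_inj.
  have ltk' : k < n.+1 by apply: ltnW.
  pose i : 'I_n := Ordinal (ltk : k < n).
  have Ei : adj_tperm i = tperm (Ordinal ltk') (Ordinal ltk).
    by rewrite /adj_tperm; congr (tperm _ _); apply: val_inj.
  case: (eqVneq k 0) => [k0 | k_neq0].
    rewrite (_ : ord0 = Ordinal ltk'); last by apply: val_inj; rewrite /= k0.
    by rewrite -Ei.
  rewrite (_ : tperm _ _ = tperm ord0 (Ordinal ltk') ^ adj_tperm i).
    by rewrite conjgE {1}Ei tpermV -Ei; apply: (WM) => //; apply: (WM).
  rewrite tpermJ Ei tpermL tpermD // -val_eqE //=.
case: (prod_tpermP s) => ts -> _.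
elim: ts => [|[x y] ts IHts]; first by rewrite big_nil.
rewrite big_cons; apply: (WM) => //=.
have {}W0 z : W (tperm ord0 z) by case: z.
case: (eqVneq x ord0) => [-> // | x0]; case: (eqVneq y ord0) => [-> | y0].
  by rewrite tpermC.
case: (eqVneq x y) => [-> | xy]; first by rewrite tperm1.
rewrite (_ : tperm x y = tperm ord0 y ^ tperm ord0 x).
  by rewrite conjgE tpermV; apply: (WM) => //; apply: (WM).
by rewrite tpermJ tpermL tpermD // eq_sym.
Qed.

Lemma word_perm_tuple_surj n (s : 'S_n.+1) :
  exists l, [exists w : l.-tuple 'I_n, word_perm w == s].
Proof.
have [w ws] := word_perm_surj s.
by exists (size w); apply/existsP; exists (in_tuple w); apply/eqP.
Qed.

Definition perm_length n (s : 'S_n.+1) : nat := ex_minn (word_perm_tuple_surj s).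

Lemma perm_length_min n (w : seq 'I_n) : perm_length (word_perm w) <= size w.
Proof.
rewrite /perm_length; case: ex_minnP => l _; apply.
by apply/existsP; exists (in_tuple w).
Qed.

Definition reduced_words n (s : 'S_n.+1) : {set (perm_length s).-tuple 'I_n} :=
  [set w : (perm_length s).-tuple 'I_n | word_perm w == s].

Definition commutation n (u v : seq 'I_n) : bool :=
  [exists k : 'I_(size u), exists i : 'I_n, exists j : 'I_n,
    [&& (i.+1 < j) || (j.+1 < i),
        u == take k u ++ [:: i, j & drop k.+2 u] &
        v == take k u ++ [:: j, i & drop k.+2 u]]].

Lemma commutationP n (u v : seq 'I_n) :
  reflect (exists p q : seq 'I_n, exists i j : 'I_n,
             [/\ (i.+1 < j) || (j.+1 < i), u = p ++ [:: i, j & q]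
               & v = p ++ [:: j, i & q]])
          (commutation u v).
Proof.
apply: (iffP idP) => [/existsP[k /existsP[i /existsP[j]]] | [p [q [i [j]]]]].
  case/and3P=> ij /eqP uE /eqP vE.
  by exists (take k u), (drop k.+2 u), i, j.
case=> ij uE vE.
have ltk : size p < size u by rewrite uE size_cat /= -addSnnS leq_addr.
apply/existsP; exists (Ordinal ltk); apply/existsP; exists i.
apply/existsP; exists j; rewrite ij /= vE uE take_size_cat //.
have -> : drop (size p).+2 (p ++ [:: i, j & q]) = q.
  by rewrite -addn2 addnC -drop_drop drop_size_cat //= drop0.
by rewrite !eqxx.
Qed.

(* Commutations preserve both length and word_perm, so it is harmless that
   connect ranges over all words of length perm_length s. *)
Definition commutation_classes n (s : 'S_n.+1) :
    {set {set (perm_length s).-tuple 'I_n}} :=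
  equivalence_partition
    (connect (fun u v : (perm_length s).-tuple 'I_n => commutation u v))
    (reduced_words s).

(* Main.v *)
Require Import Defs.
From mathcomp Require Import all_boot all_order all_fingroup all_algebra.
From mathcomp Require Import zify lra.

(* Put E(s) = |R(s)| - 2|C(s)| + 2 and let D be the set of left descents of s.
   Sorting words by their first letter gives |R(s)| = sum_(i in D) |R(s_i s)|,
   and C(s) is covered by the sets A_i of classes having a word that starts
   with i, where |A_i| <= |C(s_i s)| and A_i meets A_j when i, j in D commute.
   If the commutation graph on D is connected, this saves |D| - 1 classes and
   E(s) >= sum_(i in D) E(s_i s).  It is connected unless D is {i, i+1} or
   {i, i+1, i+2}; then E(s) >= sum_(i in D) E(s_i s) - 2.  Induction on the
   length gives E(s) >= 1 for every s other than s_i s_(i+1) s_i, for which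
   E(s) = 0.  The delicate case is D = {a, b} with s = a b a k r, where k
   commutes with b only: there s_b s = a k b r and
   E(s_b s) >= E(k b r) >= E(k r) + E(b r). *)

Set Implicit Arguments.
Unset Strict Implicit.
Unset Printing Implicit Defensive.

Import Order.TTheory GRing.Theory Num.Theory.

(** * Left descents, inversions and length *)

Definition swap_nat (i k : nat) : nat :=
  if k == i then i.+1 else if k == i.+1 then i else k.

Ltac swap_cases := rewrite /swap_nat; repeat (
  match goal with |- context [if (?a == ?b) then _ else _] =>
    lazymatch a with
    | context [if _ then _ else _] => fail
    | _ => case: (@eqP _ a b) => ?
    end
  end; try lia).

Section Descents.
Import GroupScope.
Variable n : nat.
Implicit Types (s t : 'S_n.+1) (i j k : 'I_n) (x y : 'I_n.+1).

Lemma adj_tpermE i x : adj_tperm i x = swap_nat i x :> nat.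
Proof.
rewrite /adj_tperm /swap_nat; case: tpermP => [->|->|] /=.
- by rewrite eqxx.
- by rewrite /bump /= add1n eqxx (gtn_eqF (ltnSn i)).
by move=> /eqP; rewrite -val_eqE /= => /negbTE -> /eqP;
  rewrite -val_eqE /= => /negbTE ->.
Qed.

(* Left multiplication by [s_i] in the paper's convention. *)
Definition smul s i : 'S_n.+1 := s * adj_tperm i.

Lemma smulK s i : smul (smul s i) i = s.
Proof. by rewrite /smul -mulgA /adj_tperm tperm2 mulg1. Qed.

(** The position of the value [k] in one-line notation. For [k > n], [inord] defaults to 0, hence
    the bounds [k <= n] below. *)
Definition pos s (k : nat) : nat := s^-1 (inord k).

Lemma pos_inj s (k l : nat) : k <= n -> l <= n -> pos s k = pos s l -> k = l.
Proof.
move=> kn ln /val_inj /perm_inj /(congr1 val) /=.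
by rewrite !inordK.
Qed.

Lemma pos_smul s i (k : nat) : k <= n -> pos (smul s i) k = pos s (swap_nat i
  k).
Proof.
move=> kn; rewrite /pos /smul invMg permM tpermV -/(adj_tperm i).
suff -> : adj_tperm i (inord k) = inord (swap_nat i k) by [].
apply: val_inj; rewrite /= adj_tpermE !inordK // /swap_nat.
by have := ltn_ord i; do 2?case: ifP; lia.
Qed.

(* [i] is a left descent: [i.+1] precedes [i] in the one-line notation of [s].
  *)
Definition des s i : bool := pos s i.+1 < pos s i.

Definition adj i j : bool := (i.+1 == j) || (j.+1 == i).
Definition far i j : bool := (i.+1 < j) || (j.+1 < i).

Lemma des_smul_self s i : des (smul s i) i = ~~ des s i.
Proof.
have hi := ltn_ord i; have := @pos_inj s i i.+1 (ltnW hi) hi.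
by rewrite /des !pos_smul; try lia; swap_cases.
Qed.

Lemma des_smul_far s i j : far i j -> des (smul s i) j = des s j.
Proof.
rewrite /far /des => hf; have hi := ltn_ord i; have hj := ltn_ord j.
by rewrite !pos_smul; try lia; swap_cases.
Qed.

Lemma des_smul_adj s i j : adj i j -> des s i -> des s j -> des (smul s i) j.
Proof.
rewrite /adj /des => hf; have hi := ltn_ord i; have hj := ltn_ord j.
rewrite !pos_smul; try lia.
by have [e|e] : i.+1 = j \/ j.+1 = i by [lia]; rewrite -e; swap_cases.
Qed.

Lemma swap_nat_le i (k : nat) : k <= n -> swap_nat i k <= n.
Proof. by have := ltn_ord i; swap_cases. Qed.

(** For adjacent [i] and [j], $s_i s_j$ carries the values $i, i+1$ to $j, j+1$ in this order. *)
Lemma des_smul2_adj s i j : adj i j -> des (smul (smul s i) j) i = des s j.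
Proof.
rewrite /adj /des => hf; have hi := ltn_ord i; have hj := ltn_ord j.
rewrite !pos_smul ?swap_nat_le //; try lia.
by have [e|e] : i.+1 = j \/ j.+1 = i by [lia]; rewrite -e; swap_cases.
Qed.

Lemma eq_pos s t : (forall k : nat, k <= n -> pos s k = pos t k) -> s = t.
Proof.
move=> h; apply: invg_inj; apply/permP => -[k kn]; apply: val_inj.
have := h k kn; rewrite /pos (_ : inord k = Ordinal kn) //.
by apply: val_inj; rewrite /= inordK.
Qed.

Lemma smul_far s i j : far i j -> smul (smul s i) j = smul (smul s j) i.
Proof.
rewrite /far => hf; have hi := ltn_ord i; have hj := ltn_ord j.
apply: eq_pos => k kn; rewrite !pos_smul ?swap_nat_le //.
by congr (pos _ _); swap_cases.
Qed.

Lemma smul_braid s i j : adj i j ->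
  smul (smul (smul s i) j) i = smul (smul (smul s j) i) j.
Proof.
rewrite /adj => hf; have hi := ltn_ord i; have hj := ltn_ord j.
apply: eq_pos => k kn; rewrite !pos_smul ?swap_nat_le //.
by congr (pos _ _); swap_cases.
Qed.

(** Pairs of values rather than of positions: [smul s i] then moves both entries by
    [adj_tperm i]. *)
Definition inversions s : {set 'I_n.+1 * 'I_n.+1} :=
  [set xy : 'I_n.+1 * 'I_n.+1 | (xy.1 < xy.2) && (s^-1 xy.2 < s^-1 xy.1)].
Definition ninv s : nat := #|inversions s|.

(** Applying $s_i$ to both entries matches the inversions of [smul s i] with those of [s] other than
    $(i, i+1)$. *)
Lemma ninv_smul s i : des s i -> ninv s = (ninv (smul s i)).+1.
Proof.
move=> d; have hi := ltn_ord i.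
pose a := widen_ord (leqnSn n) i; pose b : 'I_n.+1 := lift ord0 i.
have Ea : a = i :> nat by []. have Eb : b = i.+1 :> nat by [].
have Da : s^-1 b < s^-1 a.
  by move: d; rewrite /des -Eb -[X in _ < pos s X]Ea /pos !inord_val.
have abI : (a, b) \in inversions s by rewrite inE /= Da andbT; apply: leqnn.
rewrite /ninv (cardsD1 (a, b)) abI add1n; congr _.+1.
pose phi (xy : 'I_n.+1 * 'I_n.+1) := (adj_tperm i xy.1, adj_tperm i xy.2).
have phiI : injective phi.
  by move=> [x y] [x' y'] [/perm_inj -> /perm_inj ->].
rewrite -(card_preimset _ phiI); apply: eq_card => -[x y].
rewrite !inE /= /smul invMg tpermV !permM xpair_eqE -!val_eqE /= -/(adj_tperm
  i).
case ll : (s^-1 (adj_tperm i y) < s^-1 (adj_tperm i x));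
  rewrite ?andbF // !andbT.
(* This is the only increasing pair whose order $s_i$ reverses. *)
have nab : ~ (x = i :> nat /\ y = i.+1 :> nat).
  case=> xa yb; move: ll; have {xa}-> : x = a by apply: val_inj.
  have {yb}-> : y = b by apply: val_inj.
  rewrite /adj_tperm tpermL tpermR => h.
  by have := ltn_trans h Da; rewrite ltnn.
have nxy : x <> y :> nat by move/val_inj => e; rewrite e ltnn in ll.
rewrite /bump /= add1n !adj_tpermE.
by apply/idP/idP; swap_cases.
Qed.

Lemma ninv1 : ninv 1 = 0.
Proof.
by apply/eqP; rewrite cards_eq0; apply/eqP/setP => -[x y];
  rewrite !inE invg1 !perm1 /=; lia.
Qed.

Lemma ninv_smul_le s i : ninv (smul s i) <= (ninv s).+1.
Proof.
case d: (des s i); first by rewrite (ninv_smul d); lia.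
have : des (smul s i) i by rewrite des_smul_self d.
by move/ninv_smul; rewrite smulK; lia.
Qed.

(** Positions increase strictly with the values, so induction from 0 gives [k <= pos s k] and
    induction down from [n] the converse. *)
Lemma no_des s : (forall i, ~~ des s i) -> s = 1.
Proof.
move=> h.
have step (k : nat) : k < n -> pos s k < pos s k.+1.
  move=> kn; have := h (Ordinal kn); rewrite /des /=.
  have := @pos_inj s k k.+1; lia.
have ge : forall k : nat, k <= n -> k <= pos s k.
  by elim=> // k IH kn; have := step k kn; have := IH (ltnW kn); lia.
have le m : m <= n -> pos s (n - m) <= n - m.
  elim: m => [|m IH] mn; first by rewrite subn0 /pos;
    have := ltn_ord (s^-1 (inord n)); lia.
  by have := IH (ltnW mn); have := step (n - m.+1); rewrite subnSK //; lia.
apply: eq_pos => k kn; rewrite {2}/pos invg1 perm1 inordK //.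
by have := ge _ kn; have := le (n - k); rewrite subKn //; lia.
Qed.

Lemma ninv_smul_lt s i : des s i -> ninv (smul s i) < ninv s.
Proof. by move/ninv_smul => ->. Qed.

Lemma exists_des s : s != 1 -> exists i, des s i.
Proof.
move=> s1; case: (pickP (des s)) => [i di|h]; first by exists i.
by case/eqP: s1; apply: no_des => i; rewrite h.
Qed.

Lemma ninv_gt0 s i : des s i -> 0 < ninv s.
Proof. by move/ninv_smul ->. Qed.

Lemma ninv_word (w : seq 'I_n) : ninv (word_perm w) <= size w.
Proof. by elim: w => [|i w IH] /=; [rewrite ninv1 | have := ninv_smul_le
  (word_perm w) i; rewrite /smul; lia]. Qed.

Lemma word_ninv s : exists w : seq 'I_n, word_perm w = s /\ size w = ninv s.
Proof.
have [m] := ubnP (ninv s); elim: m s => // m IH s le.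
have [->|/exists_des[i di]] := eqVneq s 1; first by exists [::]; rewrite ninv1.
have [|w [ws wl]] := IH (smul s i); first by have := ninv_smul di; lia.
by exists (i :: w); rewrite /= ws wl -(ninv_smul di); split;
  rewrite // -/(smul _ i) smulK.
Qed.

(** Peeling off descents produces a word of size [ninv s]; no word is shorter, since a letter adds
    at most one inversion. *)
Lemma perm_length_ninv s : perm_length s = ninv s.
Proof.
apply/eqP; rewrite eqn_leq; apply/andP; split.
  by have [w [ws wl]] := word_ninv s; rewrite -wl -ws perm_length_min.
rewrite /perm_length; case: ex_minnP => l /existsP[w /eqP <-] _.
by rewrite -[leqRHS](size_tuple w) ninv_word.
Qed.

(** The letters [i], [j], [i] can be peeled off in turn. *)
Lemma ninv_adj s i j : adj i j -> des s i -> des s j -> 2 < ninv s.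
Proof.
move=> a di dj; rewrite (ninv_smul di) (ninv_smul (des_smul_adj a di dj)).
by rewrite (@ninv_smul _ i) // des_smul2_adj.
Qed.

End Descents.

(** * Cardinality of unions with overlaps *)

Section Covers.
Variables (T I : finType) (P : pred I) (A : I -> {set T}).

Lemma leq_card_bigcup : #|\bigcup_(i | P i) A i| <= \sum_(i | P i) #|A i|.
Proof.
elim/big_rec2: _ => [|i m B _ IH]; first by rewrite cards0.
by rewrite (leq_trans (leq_card_setU _ _)) // leq_add2l.
Qed.

Lemma leq_card_bigcup2 p q : P p -> P q -> p != q -> A p :&: A q != set0 ->
  #|\bigcup_(i | P i) A i| < \sum_(i | P i) #|A i|.
Proof.
move=> Pp Pq pq; rewrite -card_gt0 => ne.
rewrite (bigD1 p) //= (bigD1 q) /=; last by rewrite Pq eq_sym.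
rewrite [ltnRHS](bigD1 p) //= [X in _ < _ + X](bigD1 q) /=;
  last by rewrite Pq eq_sym.
rewrite setUA addnA; apply: leq_ltn_trans (leq_card_setU _ _) _.
rewrite -addSn leq_add //; first by rewrite cardsU;
  have := subset_leq_card (subsetIl (A p) (A q)); lia.
elim/big_rec2: _ => [|i m B _ IH]; first by rewrite cards0.
by rewrite (leq_trans (leq_card_setU _ _)) // leq_add2l.
Qed.

(** Once [A p] and [A q] are merged, every further set meets their union, so each set after the
    first saves a point. *)
Lemma leq_card_bigcup_star p q : P p -> P q -> p != q -> A p :&: A q != set0 ->
  (forall j, P j -> j != p -> j != q ->
    (A j :&: A p != set0) || (A j :&: A q != set0)) ->
  #|\bigcup_(i | P i) A i| + #|P| <= (\sum_(i | P i) #|A i|).+1.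
Proof.
move=> Pp Pq pq; rewrite -card_gt0 => ne star.
rewrite -(sum1_card P) (bigD1 p) //= (bigD1 q) /=; last by rewrite Pq eq_sym.
rewrite [X in _ + X](bigD1 p) //= [X in _ + (_ + X)](bigD1 q) /=;
  last by apply/andP; rewrite eq_sym.
rewrite [X in _ <= X.+1](bigD1 p) //= [X in _ <= (_ + X).+1](bigD1 q) /=;
  last by rewrite Pq eq_sym.
set B := \bigcup_(i | _) A i; set N := (N in _ + (1 + (1 + N))).
set M := (M in _ <= (_ + (_ + M)).+1); pose U := A p :|: A q.
have UE : #|U| < #|A p| + #|A q|.
  by rewrite cardsU; have := subset_leq_card (subsetIl (A p) (A q)); lia.
have UB : #|A p :|: (A q :|: B)| <= #|U| + #|B :\: U|.
  rewrite setUA -/U (_ : U :|: B = U :|: (B :\: U)) ?leq_card_setU //.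
  by apply/setP => x; rewrite !inE; do !case: (x \in _).
(* Each of the [N] remaining sets loses at least one point to [U]. *)
suff : #|B :\: U| + N <= M by lia.
rewrite {UB}/B /N /M; elim/big_rec3: _ => [|i m k B /andP[/andP[Pi ip] iq] IH].
  by rewrite set0D cards0.
suff : #|(A i :|: B) :\: U| + 1 <= #|A i| + #|B :\: U| by lia.
rewrite setDUl.
have : 0 < #|A i :&: U|.
  by rewrite card_gt0 /U setIUr setU_eq0 negb_and star.
have := (leq_card_setU (A i :\: U) (B :\: U)).1.
by have := cardsID U (A i); lia.
Qed.

End Covers.

(** * Reduced words and commutation classes sorted by first letter *)

Section Words.
Import GroupScope.
Variable n : nat.
Implicit Types (s t : 'S_n.+1) (i j k : 'I_n).

(** The length [l] is free, so that prepending a letter needs no cast; [l = ninv s] gives the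
    reduced words. *)
Definition words l s : {set l.-tuple 'I_n} :=
  [set w : l.-tuple 'I_n | word_perm w == s].

Lemma mem_words l s (w : l.-tuple 'I_n) : (w \in words l s) = (word_perm w ==
  s).
Proof. by rewrite inE. Qed.

Definition comm_rel l : rel (l.-tuple 'I_n) := fun u v => commutation u v.

Definition cls l (u : l.-tuple 'I_n) : {set l.-tuple 'I_n} :=
  [set v | connect (@comm_rel l) u v].

Lemma comm_rel_sym l : symmetric (@comm_rel l).
Proof.
suff h u v : @comm_rel l u v -> comm_rel v u by move=> u v; apply/idP/idP;
  apply: h.
case/commutationP=> p [q [i [j [ij uE vE]]]]; apply/commutationP.
by exists p, q, j, i; rewrite orbC.
Qed.

Lemma cls_eq l (u v : l.-tuple 'I_n) : connect (@comm_rel l) u v -> cls u = cls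
  v.
Proof.
move=> uv; apply/setP => w; rewrite !inE.
exact: (same_connect (sym_connect_sym (@comm_rel_sym l)) uv).
Qed.

Lemma comm_rel_word_perm l (u v : l.-tuple 'I_n) :
  comm_rel u v -> word_perm u = word_perm v.
Proof.
case/commutationP=> p [q [i [j [ij -> ->]]]]; rewrite !word_perm_cat /=.
by congr (_ * _); apply: (@smul_far _ (word_perm q)); rewrite /far orbC.
Qed.

Lemma connect_word_perm l (u v : l.-tuple 'I_n) :
  connect (@comm_rel l) u v -> word_perm u = word_perm v.
Proof.
case/connectP=> p; elim: p u => [u _ -> //|w p IH u /= /andP[uw wp] e].
by rewrite (comm_rel_word_perm uw); apply: IH.
Qed.

Lemma commutation_classesE s :
  commutation_classes s = @cls (perm_length s) @: words (perm_length s) s.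
Proof.
apply: eq_in_imset => u; rewrite inE => /eqP us.
apply/setP => v; rewrite !inE; case: (boolP (connect _ u v));
  rewrite ?andbF // => uv.
by rewrite -(connect_word_perm uv) us eqxx.
Qed.

Lemma connect_cons l i (u v : l.-tuple 'I_n) : connect (@comm_rel l) u v ->
  connect (@comm_rel l.+1) (cons_tuple i u) (cons_tuple i v).
Proof.
case/connectP=> p; elim: p u => [u _ -> //|w p IH u /= /andP[uw wp] e].
apply: connect_trans (IH _ wp e); apply: connect1.
case/commutationP: uw => p' [q [a [b [ab uE wE]]]]; apply/commutationP.
by exists (i :: p'), q, a, b; rewrite /= uE wE.
Qed.

(** Prepending [i] to a class; the union avoids choosing a representative. *)
Definition ext l i (X : {set l.-tuple 'I_n}) : {set l.+1.-tuple 'I_n} :=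
  \bigcup_(u in X) cls (cons_tuple i u).

Lemma ext_cls l i (u : l.-tuple 'I_n) : ext i (cls u) = cls (cons_tuple i u).
Proof.
apply/eqP; rewrite eqEsubset; apply/andP; split.
  apply/bigcupsP => v; rewrite inE => /(connect_cons i) /cls_eq ->.
  exact: subxx.
by apply: (bigcup_sup u); rewrite inE.
Qed.

Definition num_words s := #|words (ninv s) s|.
Definition num_classes s := #|@cls (ninv s) @: words (ninv s) s|.

(** Prepending [i] embeds the reduced words of [smul s i] into those of [s] with first letter
    [i]. *)
Lemma num_words_smul s : \sum_(i | des s i) num_words (smul s i) <= num_words s.
Proof.
case El: (ninv s) => [|l].
  by rewrite big_pred0 // => i; apply/negbTE/negP => /ninv_gt0; rewrite El.
rewrite /num_words El -[#|words _ s|]sum1_card (partition_big (@thead l 'I_n)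
  xpredT) //=.
rewrite [leqRHS](bigID (des s)) /=; apply: leq_trans (leq_addr _ _).
apply: leq_sum => i di; have /eq_add_S <- : l.+1 = (ninv (smul s i)).+1.
  by rewrite -El; apply: ninv_smul.
have consI : injective (@cons_tuple l 'I_n i) by move=> u v [e]; apply: val_inj.
rewrite sum1dep_card -[leqLHS](card_imset _ consI).
apply/subset_leq_card/subsetP => w /imsetP[u]; rewrite mem_words => /eqP us ->.
by rewrite inE mem_words theadE eqxx andbT /= us -/(smul _ _) smulK.
Qed.

(** The set $A_i$ of classes with a word starting with [i], written as an image to bound its size by
    the classes of [smul s i]. *)
Definition starting l s i : {set {set l.+1.-tuple 'I_n}} :=
  ext i @: (@cls l @: words l (smul s i)).

Lemma classes_starting l s : ninv s = l.+1 ->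
  @cls l.+1 @: words l.+1 s \subset \bigcup_(i | des s i) starting l s i.
Proof.
move=> El; apply/subsetP => X /imsetP[w ws ->].
move: w ws; case/tupleP => i u; rewrite mem_words => /eqP us.
have uE : word_perm u = smul s i by rewrite -us /= -/(smul _ _) smulK.
apply/bigcupP; exists i; last first.
  by rewrite -ext_cls; do 2!apply: imset_f; rewrite mem_words uE.
(* If [i] were no descent, [smul s i] would have length [l.+2], too long for the word [u] of size
   [l]. *)
apply: contraT => ndi; have di : des (smul s i) i by rewrite des_smul_self.
have := ninv_word u; rewrite uE size_tuple (ninv_smul di) smulK El; lia.
Qed.

(** A reduced word $i\,j\,u$ of [s] is one commutation away from $j\,i\,u$. *)
Lemma far_starting l s i j : ninv s = l.+1 -> des s i -> des s j -> far i j ->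
  starting l s i :&: starting l s j != set0.
Proof.
move=> El di dj ij.
have dij : des (smul s i) j by rewrite des_smul_far.
have [w [ws]] := word_ninv (smul (smul s i) j).
have : (ninv (smul (smul s i) j)).+2 = l.+1 by rewrite -El (ninv_smul di)
  (ninv_smul dij).
case: l El => [|l] El [] // <- /eqP wl; pose u := Tuple wl.
apply/set0Pn; exists (cls (cons_tuple i (cons_tuple j u))).
rewrite inE -ext_cls; apply/andP; split.
  by do 2!apply: imset_f; rewrite mem_words /= ws -/(smul _ _) smulK.
rewrite ext_cls (@cls_eq _ _ (cons_tuple j (cons_tuple i u))).
  rewrite -ext_cls; do 2!apply: imset_f.
  by rewrite mem_words /= ws smul_far // -/(smul _ _) smulK.
apply: connect1; apply/commutationP; exists [::], u, i, j; split => //.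
Qed.

(** Here [r] counts the classes saved by overlaps of the sets [starting l s i]. *)
Lemma num_classes_smul r l s : ninv s = l.+1 ->
  #|\bigcup_(i | des s i) starting l s i| + r
    <= \sum_(i | des s i) #|starting l s i| ->
  num_classes s + r <= \sum_(i | des s i) num_classes (smul s i).
Proof.
move=> El h; apply: (@leq_trans (\sum_(i | des s i) #|starting l s i|)).
  rewrite (leq_trans _ h) // leq_add2r /num_classes El.
  exact/subset_leq_card/classes_starting.
apply: leq_sum => i di; rewrite /num_classes.
have /eq_add_S <- : l.+1 = (ninv (smul s i)).+1 by rewrite -El;
  apply: ninv_smul.
exact: leq_imset_card.
Qed.

End Words.

(** * Braids and the possible shapes of the descent set *)

Section Adjacency.
Import GroupScope.
Variable n : nat.
Implicit Types (s t : 'S_n.+1) (i j k x y : 'I_n).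

Variant adjacency_spec i j : Prop :=
  | AdjEq of i = j
  | AdjAdj of adj i j
  | AdjFar of far i j.

Lemma adjacencyP i j : adjacency_spec i j.
Proof.
case: (eqVneq i j) => [->|ij]; first exact: AdjEq.
case a : (adj i j); first exact: AdjAdj.
by apply: AdjFar; move: ij a; rewrite -val_eqE /adj /far /=; lia.
Qed.

Lemma adjC i j : adj i j = adj j i.
Proof. by rewrite /adj orbC. Qed.

Lemma farC i j : far i j = far j i.
Proof. by rewrite /far orbC. Qed.

Lemma adj_neq i j : adj i j -> i != j.
Proof. by rewrite -val_eqE /adj /=; lia. Qed.

Lemma far_neq i j : far i j -> i != j.
Proof. by rewrite -val_eqE /far /=; lia. Qed.

Lemma adj_nfar i j : adj i j -> far i j -> False.
Proof. by rewrite /adj /far; lia. Qed.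

Lemma adj_adj_far i j k : adj i j -> adj j k -> k != i -> far i k.
Proof. by rewrite -val_eqE /adj /far /=; lia. Qed.

Lemma far_edge i x y : adj x y -> i != x -> i != y -> far i x \/ far i y.
Proof. by rewrite -!val_eqE /adj /far /=; lia. Qed.

(** By [ninv_adj] the length 3 is minimal here, so [s] is exactly $s_i s_j s_i$. *)
Definition braid s : bool :=
  (ninv s == 3) && [exists i, exists j, [&& adj i j, des s i & des s j]].

(** Take [i] far from [x]. If [i] is adjacent to [y], both remain descents after removing [x];
    otherwise [x] and [y] remain after removing [i]. Either way length 3 is left. *)
Lemma ninv_three s x y i : adj x y -> des s x -> des s y -> des s i ->
  i != x -> i != y -> 3 < ninv s.
Proof.
move=> xy dx dy di ix iy; wlog fx : x y xy dx dy ix iy / far i x.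
  move=> h; case: (far_edge xy ix iy) => f; first exact: (h x y).
  by apply: (h y x) => //; rewrite adjC.
rewrite (ninv_smul dx) ltnS; have dxy := des_smul_adj xy dx dy.
have dxi : des (smul s x) i by rewrite des_smul_far // farC.
case: (adjacencyP i y) iy => [->|iy _|iy _]; first by rewrite eqxx.
  exact: ninv_adj iy dxi dxy.
suff : 2 < ninv (smul s i) by have := ninv_smul di; have := ninv_smul dx; lia.
by apply: (ninv_adj xy); rewrite des_smul_far.
Qed.

Lemma braid_adj s i j : braid s -> des s i -> des s j -> i != j -> adj i j.
Proof.
case/andP=> /eqP s3 /existsP[x /existsP[y /and3P[xy dx dy]]] di dj ij.
have h k : des s k -> k = x \/ k = y.
  move=> dk; case: (eqVneq k x) => [|kx]; first by left.
  case: (eqVneq k y) => [|ky]; first by right.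
  by have := ninv_three xy dx dy dk kx ky; rewrite s3.
have [e|e] := h i di; have [e'|e'] := h j dj; move: ij; rewrite e e' ?eqxx //.
by rewrite adjC.
Qed.

Lemma braid_mate s i : braid s -> des s i -> exists2 j, adj i j & des s j.
Proof.
move=> bs di; case/andP: (bs) => _ /existsP[x /existsP[y /and3P[xy dx dy]]].
case: (eqVneq i x) => [->|ix]; first by exists y.
by exists x => //; apply: braid_adj bs di dx ix.
Qed.

Lemma braid_ninv s : braid s -> ninv s = 3.
Proof. by case/andP=> /eqP. Qed.

(** [DesFar] is the connected commutation graph with at least two vertices; [DesTwo] and [DesThree]
    are the disconnected ones. *)
Variant descents_spec s : Prop :=
  | DesOne k of des s =1 pred1 k
  | DesTwo a b of adj a b & des s =1 pred2 a b
  | DesThree a b c of adj a b & adj b c & far a c & des s =1 pred3 a b c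
  | DesFar p q of des s p & des s q & far p q &
      (forall j, des s j -> j != p -> j != q -> far j p || far j q).

(** The gap between the extreme descents [m] and [M] decides. From 3 on, every other descent is far
    from one of them; at 2, the middle letter settles the case. *)
Lemma descentsP s : s != 1 -> descents_spec s.
Proof.
case/exists_des=> i0 d0.
case: (@arg_minnP _ i0 (des s) val d0) => m dm mmin.
case: (@arg_maxnP _ i0 (des s) val d0) => M dM Mmax.
have mM : m <= M := mmin M dM.
have hle j : des s j -> m <= j <= M by move=> dj; rewrite (mmin _ dj);
  apply: Mmax.
have veq j k : (j == k) = (j == k :> nat) by rewrite -val_eqE.
case: (posnP (M - m)) => [e|e0].
  apply: (DesOne (k := m)) => j /=; rewrite veq;
    apply/idP/eqP => [/hle|/val_inj ->] //.
  by lia.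
case: (eqVneq (M - m) 1%N) => [e|e1].
  apply: (DesTwo (a := m) (b := M)) => [|j /=]; first by rewrite /adj; lia.
  rewrite !veq; apply/idP/idP => [/hle|/orP[/eqP/val_inj ->|/eqP/val_inj ->]]
    //.
  by lia.
case: (eqVneq (M - m) 2) => [e|e2]; last first.
  apply: (DesFar dm dM); first by rewrite /far; lia.
  by move=> j /hle; rewrite !veq /far; lia.
have bn : m.+1 < n by have := ltn_ord M; lia.
pose b := Ordinal bn; case db : (des s b); last first.
  apply: (DesFar dm dM); first by rewrite /far; lia.
  move=> j dj; have := hle j dj; rewrite !veq /far.
  have : j <> m.+1 :> nat by move=> ej; move: dj; rewrite (_ : j = b) ?db //;
    apply: val_inj.
  by lia.
apply: (DesThree (a := m) (b := b) (c := M)) => [|||j /=];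
  try by rewrite /adj /far /=; lia.
rewrite !veq; apply/idP/idP => [/hle|/or3P[/eqP/val_inj ->|/eqP e'|/eqP/val_inj
  ->]] //.
  by rewrite (_ : nat_of_ord b = m.+1) //; lia.
by rewrite (_ : j = b) //; apply: val_inj.
Qed.

End Adjacency.

(** * The excess and its recursion over descents *)

Section Excess.
Import GroupScope.
Variable n : nat.
Implicit Types (s t : 'S_n.+1) (i j k x y a b c : 'I_n).

(** This is $E(s)$, in [int] to avoid truncated subtraction; the theorem says that it is
    nonnegative. *)
Definition excess s : int := ((num_words s)%:Z - 2 * (num_classes s)%:Z + 2)%R.

Lemma sum_excess s : (\sum_(i | des s i) excess (smul s i))%R =
  ((\sum_(i | des s i) num_words (smul s i))%:Z
   - 2 * (\sum_(i | des s i) num_classes (smul s i))%:Z + 2 * #|des s|%:Z)%R.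
Proof.
rewrite -(sum1_card (des s)) !(big_morph Posz PoszD (erefl _)) !mulr_sumr.
by rewrite -sumrB -big_split.
Qed.

(** Each summand brings its own constant 2, whence the correction $2 - 2|D|$; each saved class gives
    back 2. *)
Lemma excess_smul r l s : ninv s = l.+1 ->
  #|\bigcup_(i | des s i) starting l s i| + r
    <= \sum_(i | des s i) #|starting l s i| ->
  (\sum_(i | des s i) excess (smul s i) + 2 * r%:Z + 2 - 2 * #|des s|%:Z
    <= excess s)%R.
Proof.
move=> El /(num_classes_smul El); have := num_words_smul s.
by rewrite sum_excess /excess; lia.
Qed.

Lemma ninvS s i : des s i -> exists l, ninv s = l.+1.
Proof. by move/ninv_smul; exists (ninv (smul s i)). Qed.

Lemma excess_far s p q : des s p -> des s q -> far p q ->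
  (forall j, des s j -> j != p -> j != q -> far j p || far j q) ->
  (\sum_(i | des s i) excess (smul s i) <= excess s)%R.
Proof.
move=> dp dq pq star; have [l El] := ninvS dp.
have h : #|\bigcup_(i | des s i) starting l s i| + #|des s|
    <= (\sum_(i | des s i) #|starting l s i|).+1.
  apply: (leq_card_bigcup_star dp dq (far_neq pq) (far_starting El dp dq pq)).
  move=> j dj jp jq; case/orP: (star j dj jp jq) => f.
    by rewrite (far_starting El dj dp f).
  by rewrite (far_starting El dj dq f) orbT.
(* With $r = |D| - 1$ the correction cancels; [D0] keeps the predecessor from truncating. *)
have D0 : 0 < #|des s| by apply/card_gt0P; exists p.
have := @excess_smul (#|des s|.-1) l s El; lia.
Qed.

End Excess.

(** * Lower bounds for the excess by induction on the length *)

Section Bound.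
Import GroupScope.
Variable n : nat.
Implicit Types (s t : 'S_n.+1) (i j k x y a b c : 'I_n).

Lemma excess_far_pair s p q : des s p -> des s q -> far p q ->
  (forall j, des s j -> j != p -> j != q -> far j p || far j q) ->
  (forall i, des s i -> 0 <= excess (smul s i))%R ->
  (excess (smul s p) + excess (smul s q) <= excess s)%R.
Proof.
move=> dp dq pq star ge0; apply: le_trans (excess_far dp dq pq star).
rewrite (bigD1 p) //= lerD2l (bigD1 q) /=; last by rewrite dq eq_sym far_neq.
by rewrite lerDl sumr_ge0 // => i /andP[/andP[di _] _]; apply: ge0.
Qed.

Lemma excess_one s k : des s =1 pred1 k -> (excess (smul s k) <= excess s)%R.
Proof.
move=> D; have dk : des s k by rewrite D /= eqxx.
have [l El] := ninvS dk.
have := @excess_smul _ 0 l s El; rewrite addn0 => /(_ (leq_card_bigcup _ _)).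
by rewrite (big_pred1 k) // (eq_card D) card1; lia.
Qed.

Lemma excess_two s a b : a != b -> des s =1 pred2 a b ->
  (excess (smul s a) + excess (smul s b) - 2 <= excess s)%R.
Proof.
move=> ab D; have da : des s a by rewrite D /= eqxx.
have [l El] := ninvS da.
have := @excess_smul _ 0 l s El; rewrite addn0 => /(_ (leq_card_bigcup _ _)).
rewrite (eq_card D) card2 ab (bigD1 a) //= (big_pred1 b); first by lia.
move=> i; rewrite D /=; case: (eqVneq i a) => [->|_] /=; last by rewrite andbT.
by rewrite (negbTE ab).
Qed.

(** Only the overlap for [a] and [c] is used: $2 \cdot 1 + 2 - 2 \cdot 3 = -2$. *)
Lemma excess_three s a b c : adj a b -> adj b c -> far a c ->
  des s =1 pred3 a b c ->
  (excess (smul s a) + excess (smul s b) + excess (smul s c) - 2 <= excess s)%R.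
Proof.
move=> ab bc ac D.
have [da db dc] : [/\ des s a, des s b & des s c] by rewrite !D /= !eqxx ?orbT.
have [nab nbc nac] : [/\ a != b, b != c & a != c].
  by rewrite (adj_neq ab) (adj_neq bc) (far_neq ac).
have [l El] := ninvS da.
have := @excess_smul _ 1%N l s El; rewrite addn1.
move/(_ (leq_card_bigcup2 da dc nac (far_starting El da dc ac))).
have card3 : #|des s| = 3.
  rewrite (cardD1 a) (cardD1 b) (cardD1 c) !inE /= [_ \in des s]da [b \in des
    s]db.
  rewrite [c \in des s]dc (eq_sym b a) (eq_sym c a) (eq_sym c b) nab nbc nac.
  rewrite eq_card0 // => i; rewrite !inE [i \in des s]D /=.
  by case: (i == a) (i == b) (i == c) => [] [] [].
rewrite card3 (bigD1 a) //= (bigD1 b) /=; last by rewrite db eq_sym.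
rewrite (big_pred1 c); first by lia.
move=> i; rewrite D /=.
case: (eqVneq i a) => [->|_] /=; first by rewrite (negbTE nac).
case: (eqVneq i b) => [->|_] /=; first by rewrite (negbTE nbc).
by rewrite !andbT.
Qed.

(** The strict bound away from braids carries the induction: it repays the loss of 2 in the
    disconnected cases. *)
Definition good s : Prop :=
  ((0 <= excess s) /\ (~~ braid s -> 1 <= excess s))%R.

Lemma excess1 : excess (1 : 'S_n.+1) = 1%R.
Proof.
rewrite /excess /num_words /num_classes ninv1.
have -> : words 0 (1 : 'S_n.+1) = [set [tuple]].
  by apply/setP => w; rewrite mem_words tuple0 inE !eqxx.
by rewrite imset_set1 !cards1.
Qed.

(** If [smul s k] were a braid, one of its two descents would be far from [k], hence a second
    descent of [s]. *)
Lemma good_one s k : (forall i, des s i -> good (smul s i)) ->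
  des s =1 pred1 k -> (1 <= excess s)%R.
Proof.
move=> IH D; have dk : des s k by rewrite D /= eqxx.
apply: le_trans (excess_one D); apply: (IH k dk).2; apply/negP => bt.
case/andP: (bt) => _ /existsP[x /existsP[y /and3P[xy dx dy]]].
have neq i : des (smul s k) i -> k != i.
  by move=> di; apply/eqP => e; move: di; rewrite -e des_smul_self dk.
have contra i : far k i -> des (smul s k) i -> False.
  move=> ki; rewrite des_smul_far // D /= => /eqP e.
  by have := far_neq ki; rewrite e eqxx.
by case: (far_edge xy (neq _ dx) (neq _ dy)) => /contra; apply.
Qed.

(** Both braids would contain the letter [b] between [p] and [q]; then [q], [b], [q], [p] can be
    peeled off [smul s p], which has length 3. *)
Lemma braid_far_braid s p q : des s p -> des s q -> far p q ->
  braid (smul s p) -> braid (smul s q) -> False.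
Proof.
have key p' q' : des s p' -> des s q' -> far p' q' ->
    braid (smul s p') -> braid (smul s q') ->
    exists b, [/\ adj q' b, adj b p' & des (smul s p') b].
  move=> dp dq pq bp bq; have dpq : des (smul s p') q' by rewrite des_smul_far.
  have [b qb db] := braid_mate bp dpq; exists b; split=> //.
  case: (adjacencyP b p') => // [e|f].
    by move: db; rewrite e des_smul_self dp.
  (* If [b] were far from [p'], both would be descents of the braid [smul s q'], whose descents are
     adjacent. *)
  have db' : des s b by rewrite -(@des_smul_far _ s p') // farC.
  have d1 := des_smul_adj qb dq db'.
  have d2 : des (smul s q') p' by rewrite des_smul_far // farC.
  exact: (braid_adj bq d1 d2 (far_neq f)).
move=> dp dq pq bp bq; have [b [qb bp' db]] := key p q dp dq pq bp bq.
have [|b' [pb' bq' db']] := key q p dq dp _ bq bp; first by rewrite farC.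
have e : b' = b.
  apply: val_inj; move: qb bp' pb' bq' pq; rewrite /adj /far /=; lia.
rewrite {}e in pb' bq' db'.
have dpq : des (smul s p) q by rewrite des_smul_far.
have dqp : des (smul s q) p by rewrite des_smul_far // farC.
pose t := smul (smul (smul s p) q) b.
have tq : des t q by rewrite /t des_smul2_adj.
have tp : des t p by rewrite /t (smul_far s pq) des_smul2_adj.
have d1 : des (smul (smul s p) q) b by apply: des_smul_adj.
have := braid_ninv bp; rewrite (ninv_smul dpq) (ninv_smul d1) -/t (ninv_smul
  tq).
by rewrite (@ninv_smul _ _ p) // des_smul_far // farC.
Qed.

Lemma good_far s p q : (forall i, des s i -> good (smul s i)) ->
  des s p -> des s q -> far p q ->
  (forall j, des s j -> j != p -> j != q -> far j p || far j q) ->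
  (1 <= excess s)%R.
Proof.
move=> IH dp dq pq star; have ge0 i (di : des s i) := (IH i di).1.
have := excess_far_pair dp dq pq star ge0; have := ge0 p dp; have := ge0 q dq.
have bpq := braid_far_braid dp dq pq.
case bp : (braid (smul s p)); last by have := (IH p dp).2 (negbT bp); lia.
case bq : (braid (smul s q)); last by have := (IH q dq).2 (negbT bq); lia.
by have := bpq bp bq.
Qed.

Lemma good_three s a b c : (forall i, des s i -> good (smul s i)) ->
  adj a b -> adj b c -> far a c -> des s =1 pred3 a b c ->
  (1 <= excess s)%R.
Proof.
move=> IH ab bc ac D.
have [da db dc] : [/\ des s a, des s b & des s c] by rewrite !D /= !eqxx ?orbT.
have ba : adj b a by rewrite adjC.
have dba := des_smul_adj ba db da; have dbc := des_smul_adj bc db dc.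
(* After [b] and [a] are peeled off, the adjacent descents [b] and [c] remain. So every [smul s i]
   is too long for a braid. *)
have inv5 : 4 < ninv s.
  rewrite (ninv_smul db) (ninv_smul dba) !ltnS.
  apply: (ninv_adj bc); first by rewrite des_smul2_adj.
  by rewrite des_smul_far.
have ge1 i : des s i -> (1 <= excess (smul s i))%R.
  move=> di; apply: (IH i di).2; apply/negP => /braid_ninv e.
  by have := ninv_smul di; rewrite e => e4; rewrite e4 in inv5.
move: (excess_three ab bc ac D) (ge1 a da) (ge1 b db) (ge1 c dc); clear; lia.
Qed.

(* In words, [s = a b a k r], [al = b k r] and [ta = k r]; the induction
   hypothesis falls short only if [b r] is a braid [b x b], and then the
   commuting descents [k] and [x] of [ta] make up for it. *)
Lemma good_two s a b k : (forall t, ninv t < ninv s -> good t) ->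
  adj a b -> des s =1 pred2 a b ->
  des (smul (smul (smul s a) b) a) k -> adj k a -> far k b ->
  (1 <= excess s)%R.
Proof.
move=> IH ab D; have nab := adj_neq ab; have ba : adj b a by rewrite adjC.
have [da db] : des s a /\ des s b by rewrite !D /= !eqxx ?orbT.
have only i : des s i -> i = a \/ i = b by rewrite D /= => /orP[]/eqP;
  [left|right].
rewrite smul_braid //; set al := smul (smul s b) a; set ta := smul al b.
move=> dk ka kb.
have bk : far b k by rewrite farC.
have dba : des (smul s b) a by apply: des_smul_adj.
have dab : des (smul s a) b by apply: des_smul_adj.
have alb : des al b by rewrite des_smul2_adj.
have alk : des al k by rewrite -(@des_smul_far _ al b).
have ala : ~~ des al a by rewrite des_smul_self dba.
have taa : ~~ des ta a by rewrite /ta /al -smul_braid // des_smul_self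
  des_smul2_adj // db.
have tab : ~~ des ta b by rewrite des_smul_self alb.
have lsb := ninv_smul_lt db.
have lal : ninv al < ninv s := ltn_trans (ninv_smul_lt dba) lsb.
have lta : ninv ta < ninv s := ltn_trans (ninv_smul_lt alb) lal.
have lalk : ninv (smul al k) < ninv s := ltn_trans (ninv_smul_lt alk) lal.
have ge0 t i : ninv t < ninv s -> des t i -> (0 <= excess (smul t i))%R.
  by move=> lt di; apply: (IH _ (ltn_trans (ninv_smul_lt di) lt)).1.
(* In a braid [smul s a], the neighbour [x] of [b] would be far from [a], hence a third descent of
   [s]. *)
have h1 : (1 <= excess (smul s a))%R.
  apply: (IH _ (ninv_smul_lt da)).2; apply/negP => br.
  have [x bx dx] := braid_mate br dab.
  have xa : x != a by apply: contraTneq dx => ->; rewrite des_smul_self da.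
  have ax := adj_adj_far ab bx xa.
  have /only[e|e] : des s x by rewrite -(@des_smul_far _ s a).
    by rewrite e eqxx in xa.
  by have := adj_neq bx; rewrite e eqxx.
(* Every descent of [smul s b] other than [a] commutes with [a], as one far from [b] would be a
   descent of [s]. *)
have h2 : (excess al <= excess (smul s b))%R.
  have [/existsP[j /andP[dj ja]]|none] := boolP [exists j, des (smul s b) j &&
    (j != a)].
    have fa i : des (smul s b) i -> i != a -> far a i.
      move=> di ia; apply: (adj_adj_far ab) ia.
      case: (adjacencyP b i) => // [e|f].
        by move: di; rewrite -e des_smul_self db.
      have /only[e|e] : des s i by rewrite -(@des_smul_far _ s b).
        by case: (adj_nfar ba); rewrite -e.
      by have := far_neq f; rewrite e eqxx.
    apply: le_trans (_ : excess al + excess (smul (smul s b) j) <= _)%R.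
      by rewrite lerDl ge0.
    apply: excess_far_pair => // [|i di ia _|i di]; first exact: fa.
      by rewrite farC fa.
    exact: ge0.
  apply: excess_one => j /=; apply/idP/eqP => [dj|-> //].
  by move/existsPn: none => /(_ j); rewrite dj /= negbK => /eqP.
(* Only [a] lies between the commuting descents [b] and [k], and it is no descent of [al]. *)
have h3 : (excess ta + excess (smul al k) <= excess al)%R.
  apply: excess_far_pair => // [j dj jb jk|i di]; last exact: ge0.
  have ja : j != a by apply: contraNneq ala => <-.
  move: ab ka kb jb jk ja; clear; rewrite /adj /far -!val_eqE /=; lia.
(* In a braid [ta], the neighbour [x] of [k] would lie beyond [k], far from [a] and [b], and be a
   descent of [s]. *)
have h4 : (1 <= excess ta)%R.
  apply: (IH _ lta).2; apply/negP => br; have [x kx dx] := braid_mate br dk.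
  have xa : x != a by apply: contraNneq taa => <-.
  have ak : adj a k by rewrite adjC.
  have fax := adj_adj_far ak kx xa.
  have fbx : far b x.
    by move: ab ka kb kx xa; clear; rewrite /adj /far -!val_eqE /=; lia.
  have /only[] : des s x.
  - by rewrite -(@des_smul_far _ s b) // -(@des_smul_far _ _ a) //
      -(@des_smul_far _ _ b).
  - by move/eqP; rewrite (negbTE xa).
  - by move=> e; have := far_neq fbx; rewrite e eqxx.
have h5 := excess_two nab D.
have [br|nbr] := boolP (braid (smul al k)); last first.
  have := (IH _ lalk).2 nbr; move: h1 h2 h3 h4 h5; clear; lia.
have h6 := (IH _ lalk).1.
suff h7 : (2 <= excess ta)%R by move: h1 h2 h3 h5 h6 h7; clear; lia.
have dkb : des (smul al k) b by rewrite des_smul_far.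
have [x bx dx] := braid_mate br dkb.
(* If [a] were a descent of [smul al k], then [k] would be one of [smul s b], hence of [s]. *)
have xa : x != a.
  apply: contraTneq dx => ->.
  have ak : adj a k by rewrite adjC.
  rewrite /al des_smul2_adj // des_smul_far //.
  apply/negP => /only[] e; first by have := adj_neq ka; rewrite e eqxx.
  by have := far_neq kb; rewrite e eqxx.
have kx : far k x.
  by move: ab ka kb bx xa; clear; rewrite /adj /far -!val_eqE /=; lia.
have dalx : des al x by rewrite -(@des_smul_far _ al k).
have dtx : des ta x by apply: des_smul_adj.
have ta3 : ninv ta = 3.
  have := braid_ninv br; have := ninv_smul alk; rewrite (ninv_smul alb).
  by move=> /eq_add_S ->.
(* Length 2 excludes a braid, so the commuting descents [x] and [k] each contribute 1. *)
have nb i : des ta i -> (1 <= excess (smul ta i))%R.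
  move=> di; apply: (IH _ (ltn_trans (ninv_smul_lt di) lta)).2.
  by apply/negP => /braid_ninv e; have := ninv_smul_lt di; rewrite e ta3.
apply: le_trans (lerD (nb x dtx) (nb k dk)) _.
apply: excess_far_pair => // [|j dj jx jk|i di]; first by rewrite farC.
  have ja : j != a by apply: contraNneq taa => <-.
  have jb : j != b by apply: contraNneq tab => <-.
  move: ab ka kb bx xa jx jk ja jb; clear.
  by rewrite /adj /far -!val_eqE /=; lia.
exact: ge0.
Qed.

Lemma good_all s : good s.
Proof.
have [m] := ubnP (ninv s); elim: m s => // m IHm s; rewrite ltnS => sm.
have IH t : ninv t < ninv s -> good t by move=> lt; apply: IHm; lia.
have IHd i : des s i -> good (smul s i) by move/ninv_smul_lt/IH.
have ge1 : (1 <= excess s)%R -> good s by move=> h; split=> [|_] //; lia.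
have [->|s1] := eqVneq s 1; first by split; rewrite excess1.
case: (descentsP s1) => [k D|a b ab D|a b c ab bc ac D|p q dp dq pq star].
- exact/ge1/(good_one IHd D).
- have [da db] : des s a /\ des s b by rewrite !D /= !eqxx ?orbT.
  have ba : adj b a by rewrite adjC.
  have dab := des_smul_adj ab da db.
  have daba : des (smul (smul s a) b) a by rewrite des_smul2_adj.
  (* If nothing follows $a\,b\,a$, then [s] is a braid and both summands are at least 1, giving $1 +
     1 - 2 = 0$. *)
  have [t1|/exists_des[k dk]] := eqVneq (smul (smul (smul s a) b) a) 1.
    have s3 : ninv s = 3.
      by rewrite (ninv_smul da) (ninv_smul dab) (ninv_smul daba) t1 ninv1.
    have br : braid s.
      by rewrite /braid s3 eqxx; apply/existsP; exists a; apply/existsP;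
        exists b; rewrite ab da db.
    split; last by rewrite br.
    have nb i : des s i -> (1 <= excess (smul s i))%R.
      move=> di; apply: (IHd i di).2; apply/negP => /braid_ninv e.
      by have := ninv_smul di; rewrite s3 e.
    move: (excess_two (adj_neq ab) D) (nb a da) (nb b db); clear; lia.
  have ka : k != a.
    by apply: contraTneq dk => ->; rewrite des_smul_self daba.
  have kb : k != b.
    by apply: contraTneq dk => ->; rewrite smul_braid // des_smul_self
      des_smul2_adj // da.
  have nds : ~~ des s k by rewrite D /= (negbTE ka) (negbTE kb).
  (* Being no descent of [s], [k] is far from exactly one of [a] and [b]; the braid relation lets
     them exchange roles. *)
  apply: ge1; case: (far_edge ab ka kb) => f.
    apply: (@good_two s b a k) => //.
    + by move=> i; rewrite D /= orbC.
    + by rewrite -smul_braid.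
    case: (adjacencyP k b) => // [e|f']; first by rewrite e eqxx in kb.
    by move: dk; rewrite !des_smul_far ?(negbTE nds) // farC.
  apply: (@good_two s a b k) => //.
  case: (adjacencyP k a) => // [e|f']; first by rewrite e eqxx in ka.
  by move: dk; rewrite !des_smul_far ?(negbTE nds) // farC.
- exact/ge1/(good_three IHd ab bc ac D).
- exact/ge1/(good_far IHd dp dq pq star).
Qed.

End Bound.

(** * From nonnegative excess to the rational inequality *)

Local Open Scope ring_scope.

Theorem theoremB (n : nat) (hn : (1 <= n)%N) (s : 'S_n.+1) :
  #|commutation_classes s|%:R <= 2^-1 * #|reduced_words s|%:R + 1 :> rat.
Proof.
have -> : #|commutation_classes s| = num_classes s.
  by rewrite /num_classes -perm_length_ninv commutation_classesE.
have -> : #|reduced_words s| = num_words s.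
  by rewrite /num_words -perm_length_ninv.
have : (2 * num_classes s <= num_words s + 2)%N.
  by have := (good_all s).1; rewrite /excess; lia.
by rewrite -(ler_nat rat) natrM natrD; lra.
Qed.
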